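(* Let $\beta>1$ be a constant. For every maximization problem, every instance $I$ of it with $\mathrm{opt}=\mathrm{opt}(I)\ge2$, and every solution constructed for $I$ by a present-biased agent with parameter $\beta$, of cost $c$, the cost ratio satisfies $$\varrho=\frac{\mathrm{opt}}{c}\le(1+\log\beta)\,\frac{\mathrm{opt}}{\log\mathrm{opt}} .$$
   Context: $\log$ denotes the natural logarithm. **Maximization problems.** An instance $I$ consists of a finite ground set $\mathcal S_I$, a weight function $\omega:\mathcal S_I\to\mathbb N$ (where $\mathbb N=\{1,2,\dots\}$), and a family $F(I)$ of subsets of $\mathcal S_I$, called feasible solutions; the initial instance has at least one nonempty feasible solution. The cost of $S$ is $c(S)=\sum_{x\in S}\omega(x)$, and $\mathrm{opt}(I)=\max_{S\in F(I)}c(S)$. For $x$ belonging to some feasible solution, $I\smallsetminus x$ denotes the instance obtained by assuming $x$ selected in the solution: its ground set is $\mathcal S_I\smallsetminus\{x\}$, its weights are unchanged, and its feasible solutions are the sets $S\smallsetminus\{x\}$ with $S\in F(I)$ and $x\in S$. A maximization problem is a class of instances closed under this operation. **Present-biased agent with parameter $\beta$.** Put $I_0=I$. At step $i\ge0$, the agent computes a pair $(S_i,x_i)$ with $S_i\in F(I_i)$ and $x_i\in S_i$ that maximizes the perceived value $\omega(x)+\beta\,c(S\smallsetminus\{x\})$ among all pairs $(S,x)$ with $S\in F(I_i)$ and $x\in S$, and selects $x_i$. Ties are broken arbitrarily. The agent stops as soon as $\{x_0,\dots,x_i\}$ is an inclusion-wise maximal feasible solution of $I$; otherwise it continues with $I_{i+1}=I_i\smallsetminus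 x_i$. The constructed solution is $\{x_0,\dots,x_k\}$, where $k$ is the last step, and its cost is $c=\sum_{i=0}^k\omega(x_i)$. *)

(* Defs.v *)
From mathcomp Require Import all_boot all_order all_algebra.
From mathcomp Require Import finmap.
From mathcomp Require Import reals exp.

Set Implicit Arguments.
Unset Strict Implicit.
Unset Printing Implicit Defensive.

Import Order.TTheory GRing.Theory Num.Theory.

Local Open Scope fset_scope.

(* Ground sets are finite sets over an arbitrary, possibly infinite, universe
   [T], so that one problem may contain instances of unbounded size.  The
   weight function is total on [T]; only its values on [ground] matter. *)
Record instance (T : choiceType) := Instance {
  ground : {fset T};
  weight : T -> nat;
  feasible : {fset {fset T}};
  weight_gt0 : forall x : T, x \in ground -> (0 < weight x)%N;
  feasible_sub : forall S : {fset T}, S \in feasible -> S `<=` ground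
}.

Definition cost (T : choiceType) (I : instance T) (S : {fset T}) : nat :=
  (\sum_(x <- S) weight I x)%N.

Definition opt (T : choiceType) (I : instance T) : nat :=
  (\max_(S <- feasible I) cost I S)%N.

Section Contract.
Variables (T : choiceType) (I : instance T) (x : T).

Definition contract_feasible : {fset {fset T}} :=
  [fset S `\ x | S in feasible I & x \in S].

Lemma contract_weight_gt0 (y : T) :
  y \in ground I `\ x -> (0 < weight I y)%N.
Proof. by rewrite in_fsetD1 => /andP[_]; apply: weight_gt0. Qed.

Lemma contract_feasible_sub (S : {fset T}) :
  S \in contract_feasible -> S `<=` ground I `\ x.
Proof.
by case/imfsetP=> U /=; rewrite inE => /andP[UF _] ->;
  apply: fsetSD; apply: feasible_sub.
Qed.

(* The instance I \ x.  It is only meaningful when [x] belongs to some feasible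
   solution; otherwise its feasible family is empty. *)
Definition contract : instance T :=
  Instance contract_weight_gt0 contract_feasible_sub.

End Contract.

Record maximization_problem (T : choiceType) := MaximizationProblem {
  is_instance : instance T -> Prop;
  is_instance_contract : forall (I : instance T) (x : T),
    is_instance I -> (exists2 S, S \in feasible I & x \in S) ->
    is_instance (contract I x)
}.

Definition maximal_feasible (T : choiceType) (I : instance T) (S : {fset T})
    : Prop :=
  S \in feasible I /\
  forall U : {fset T}, U \in feasible I -> S `<=` U -> U = S.

Definition perceived_value (R : realType) (T : choiceType) (beta : R)
    (I : instance T) (S : {fset T}) (x : T) : R :=
  ((weight I x)%:R + beta * (cost I (S `\ x))%:R)%R.

Definition optimal_choice (R : realType) (T : choiceType) (beta : R)
    (I : instance T) (S : {fset T}) (x : T) : Prop :=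
  [/\ S \in feasible I, x \in S &
      forall (U : {fset T}) (y : T), U \in feasible I -> y \in U ->
        (perceived_value beta I U y <= perceived_value beta I S x)%R].

(* [agent_steps beta I s]: starting from [I], the agent may select the elements
   of [s], in this order, without having stopped before the last one.
   [foldl (@contract T) I [:: x_0; ...; x_i]] is the instance I_(i+1). *)
Inductive agent_steps (R : realType) (T : choiceType) (beta : R)
    (I : instance T) : seq T -> Prop :=
| agent_first (S : {fset T}) (x : T) :
    optimal_choice beta I S x -> agent_steps beta I [:: x]
| agent_next (s : seq T) (S : {fset T}) (x : T) :
    agent_steps beta I s ->
    ~ maximal_feasible I [fset y in s] ->
    optimal_choice beta (foldl (@contract T) I s) S x ->
    agent_steps beta I (rcons s x).

Definition agent_run (R : realType) (T : choiceType) (beta : R)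
    (I : instance T) (s : seq T) : Prop :=
  agent_steps beta I s /\ maximal_feasible I [fset y in s].

(* Main.v *)
(** Comparing the optimal pair at step [i] with [S_(i-1) \ x_(i-1)] gives
    [c(S_(i-1) \ x_(i-1)) <= w(x_i) + beta * c(S_i \ x_i)], so each step loses a
    factor at most [beta]. Maximality of the constructed solution forces
    [S_k \ x_k] to be empty, hence [opt <= beta ^ (k + 1) * c]. As weights are
    at least 1, [k + 1 <= c], and therefore
    [ln opt <= c * ln beta + ln c <= (1 + ln beta) * c]. *)
Require Import Defs.
From mathcomp Require Import all_boot all_order all_algebra.
From mathcomp Require Import finmap.
From mathcomp Require Import reals exp.

Import Order.TTheory GRing.Theory Num.Theory.

Local Open Scope ring_scope.

Lemma weight_foldl_contract (T : choiceType) (I : instance T) (s : seq T) :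
  weight (foldl (@contract T) I s) = weight I.
Proof. by elim: s I => [//|x s IHs] I /=; rewrite IHs. Qed.

(** Each contraction keeps only solutions containing the contracted element and removes it from
    them; induction on [s] undoes this. At the end of a run, maximality in [I] can then be applied
    to [U]. *)
Lemma feasible_foldl_contract (T : choiceType) (I : instance T) (s : seq T)
    (S : {fset T}) :
  S \in feasible (foldl (@contract T) I s) ->
  exists U : {fset T}, [/\ U \in feasible I, ([fset y in s] `<=` U)%fset
    & S = (U `\` [fset y in s])%fset].
Proof.
elim: s I S => [|x s IHs] I S /= SF.
  exists S; split=> //; last by apply/fsetP=> y; rewrite !inE.
  by apply/fsubsetP=> y; rewrite !inE.
have [V [/imfsetP[U /=]]] := IHs _ _ SF.
rewrite inE => /andP[UF xU] -> sU ->; exists U; split=> //.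
- apply/fsubsetP=> y; rewrite !inE => /predU1P[-> //|ys].
  by have /fsubsetP/(_ y) := sU; rewrite !inE ys => /(_ isT)/andP[].
- by apply/fsetP=> y; rewrite !inE negb_or; case: (y == x); case: (y \in s).
Qed.

Lemma weight_feasible_foldl_gt0 (T : choiceType) (I : instance T) (s : seq T)
    (S : {fset T}) (x : T) :
  S \in feasible (foldl (@contract T) I s) -> x \in S -> (0 < weight I x)%N.
Proof.
move=> SF xS; rewrite -(weight_foldl_contract T I s).
by apply: weight_gt0; apply: fsubsetP xS; apply: feasible_sub.
Qed.

Section Agent.
Variables (R : realType) (beta : R) (T : choiceType).
Hypothesis beta_ge1 : 1 <= beta.

(** Pairing [V] with any of its elements already yields a perceived value of at least [cost I V],
    since [beta >= 1] only inflates the rest. An empty [V] offers no such pair but costs 0. *)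
Lemma cost_le_perceived_value (I : instance T) (V S : {fset T}) (x : T) :
  V \in feasible I -> optimal_choice beta I S x ->
  (cost I V)%:R <= perceived_value beta I S x.
Proof.
have beta_ge0 : 0 <= beta by apply: le_trans beta_ge1.
move=> VF [_ _ Smax]; have [->|[y yV]] := fset_0Vmem V.
  rewrite /cost big_seq_fset0 /perceived_value.
  by rewrite addr_ge0 ?mulr_ge0.
apply: le_trans (Smax V y VF yV).
rewrite /perceived_value /cost (big_fsetD1 y) //= natrD lerD2l.
by rewrite ler_peMl.
Qed.

Lemma opt_le_perceived_value (I : instance T) (S : {fset T}) (x : T) :
  optimal_choice beta I S x -> (opt I)%:R <= perceived_value beta I S x.
Proof.
move=> Smax; have le_cost V := cost_le_perceived_value I V S x ^~ Smax.
rewrite /opt big_seq.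
elim/big_ind: _ => [|m n le_m le_n|V /le_cost //].
  by apply: le_trans (le_cost S _); case: Smax.
by rewrite /maxn; case: ifP.
Qed.

Lemma agent_steps_size (I : instance T) (s : seq T) :
  agent_steps beta I s -> (size s <= \sum_(x <- s) weight I x)%N.
Proof.
elim=> [S x [SF xS _]|{}s S x _ IHs _ [SF xS _]].
  by rewrite big_seq1; apply: (weight_feasible_foldl_gt0 _ _ [::] S).
rewrite size_rcons -cats1 big_cat big_seq1 -addn1 leq_add //.
exact: weight_feasible_foldl_gt0 SF xS.
Qed.

(** The witness is the remainder of the last optimal pair. It is feasible after contraction, so it
    competes with the next choice. *)
Lemma agent_steps_opt (I : instance T) (s : seq T) :
  agent_steps beta I s ->
  exists2 S, S \in feasible (foldl (@contract T) I s) &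
    (opt I)%:R <=
      beta ^+ size s * ((\sum_(x <- s) weight I x)%N + cost I S)%N%:R.
Proof.
have beta_ge0 : 0 <= beta by apply: le_trans beta_ge1.
have contractF J S x : S \in feasible J -> x \in S ->
    (S `\ x)%fset \in feasible (contract J x).
  by move=> SF xS; apply/imfsetP; exists S => //=; rewrite inE SF.
elim=> [S x Smax|{}s S x _ [V VF le_opt] _ Smax]; case: (Smax) => SF xS _.
  exists (S `\ x)%fset; first exact: contractF.
  apply: le_trans (opt_le_perceived_value _ _ _ Smax) _.
  by rewrite big_seq1 natrD mulrDr lerD2r ler_peMl.
exists (S `\ x)%fset; first by rewrite foldl_rcons; apply: contractF.
apply: (le_trans le_opt).
rewrite size_rcons exprSr -mulrA ler_wpM2l ?exprn_ge0 //.
have := cost_le_perceived_value _ _ _ _ VF Smax.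
rewrite /perceived_value /cost weight_foldl_contract => le_V.
rewrite -cats1 big_cat big_seq1 /= -addnA natrD.
(* The new factor [beta >= 1] is spread over all terms: the weights collected so far only grow, and
   [w(x) + beta * c(S \ x)] is at most [beta * (w(x) + c(S \ x))]. *)
rewrite [in leRHS]natrD mulrDr lerD ?ler_peMl // (le_trans le_V) //.
by rewrite natrD mulrDr lerD2r ler_peMl.
Qed.

Lemma agent_run_opt (I : instance T) (s : seq T) :
  agent_run beta I s ->
  (opt I)%:R <= beta ^+ size s * (\sum_(x <- s) weight I x)%N%:R.
Proof.
case=> /agent_steps_opt[S /feasible_foldl_contract[U [UF sU ->]]] + [_ smax].
(* Maximality forces [U] to be the set of selected elements, so the remainder is empty. *)
by rewrite (smax U UF sU) fsetDv /cost big_seq_fset0 addn0.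
Qed.

End Agent.

Theorem corollary1 (R : realType) (beta : R) (beta_gt1 : 1 < beta)
    (T : choiceType) (P : maximization_problem T)
    (I : instance T) (PI : is_instance P I)
    (I_nonempty : exists2 S : {fset T}, S \in feasible I & S != fset0)
    (opt_ge2 : (2 <= opt I)%N)
    (s : seq T) (run_s : agent_run beta I s)
    (c : nat) (c_def : c = (\sum_(x <- s) weight I x)%N) :
  (opt I)%:R / c%:R <= (1 + ln beta) * ((opt I)%:R / ln (opt I)%:R).
Proof.
have beta_gt0 : 0 < beta by apply: lt_trans beta_gt1.
have lnb_ge0 : 0 <= ln beta by rewrite ln_ge0 // ltW.
have opt_gt0 : 0 < (opt I)%:R :> R by rewrite ltr0n ltnW.
have lnopt_gt0 : 0 < ln (opt I)%:R :> R by rewrite ln_gt0 // ltr1n.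
have size_le_c : (size s <= c)%N.
  by rewrite c_def; apply: agent_steps_size; case: run_s; eauto.
have := agent_run_opt _ _ _ (ltW beta_gt1) _ _ run_s; rewrite -c_def => opt_le.
(* With [c = 0] the bound [opt_le] would give [opt <= 0]. *)
have c_gt0 : 0 < c%:R :> R.
  rewrite lt0r ler0n andbT; apply: contraTneq opt_gt0 => c0.
  by rewrite c0 mulr0 in opt_le; rewrite -leNgt.
have lnopt_le : ln (opt I)%:R <= (1 + ln beta) * c%:R.
  apply: (@le_trans _ _ (ln (beta ^+ size s * c%:R))).
    by rewrite ler_ln ?posrE // mulr_gt0 // exprn_gt0.
  (* The summand 1 pays for [ln c < c]; the summand [ln beta >= 0] pays for the power, as
     [size s <= c]. *)
  rewrite lnM ?posrE ?exprn_gt0 // lnXn // addrC mulrDl mul1r lerD //.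
    exact: ltW (ln_sublinear c_gt0).
  by rewrite -(mulr_natr _ (size s)) ler_wpM2l // ler_nat.
by rewrite mulrCA ler_pM2l // ler_pdivlMr // mulrC ler_pdivrMr.
Qed.
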